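(* For any two polytopes $P$ and $Q$ in the same Euclidean space, $$\delta(P+Q)\geq\max\{\delta(P),\delta(Q)\}.$$
   Context: A polytope is the (nonempty) convex hull of finitely many points. $P+Q=\{p+q : p\in P,\ q\in Q\}$ is the Minkowski sum. The graph of a polytope is the graph made up of its vertices and edges ($0$- and $1$-dimensional faces), and the diameter $\delta(P)$ of a polytope $P$ is the diameter of its graph, i.e. the largest graph distance between two of its vertices. *)

(* Defs.v *)
From HB Require Import structures.
From mathcomp Require Import all_boot all_order all_algebra.
From mathcomp Require Import all_classical all_reals all_analysis.

Set Implicit Arguments.
Unset Strict Implicit.
Unset Printing Implicit Defensive.

Import Order.TTheory GRing.Theory Num.Theory.

Local Open Scope classical_set_scope.
Local Open Scope ring_scope.

Section Polytopes.
Variables (R : realType) (n : nat).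
Local Notation E := 'rV[R]_n.
Implicit Types (P Q A F : set E) (u v x y : E).

Definition convex_hull A : set E := smallest (@convex_set R E) A.

Definition is_polytope P : Prop :=
  exists2 s : seq E, s != [::] & P = convex_hull [set` s].

Definition minkowski_sum P Q : set E := [set p + q | p in P & q in Q].

(* [c = 0], [b = 0] gives [P] itself; [c = 0], [b = 1] gives the empty face. *)
Definition is_face P F : Prop :=
  exists (c : E) (b : R),
    (forall x, P x -> (x *m c^T) 0 0 <= b) /\
    F = [set x | P x /\ (x *m c^T) 0 0 = b].

Definition affine_hull A : set E :=
  [set y | exists k (a : 'I_k -> R) (x : 'I_k -> E),
     [/\ forall i, A (x i), \sum_i a i = 1 & y = \sum_i a i *: x i]].

(* Nonempty sets only: [has_dim set0 d] holds for no [d]. *)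
Definition has_dim A (d : nat) : Prop :=
  exists (p : E) (U : {vspace E}),
    \dim U = d /\ affine_hull A = [set p + w | w in [set` U]].

Definition is_vertex P v : Prop := is_face P [set v] /\ has_dim [set v] 0%N.

Definition is_edge P F : Prop := is_face P F /\ has_dim F 1%N.

Definition adjacent P u v : Prop :=
  [/\ u <> v, is_vertex P u, is_vertex P v &
      exists F, [/\ is_edge P F, F u & F v]].

(* The walk [u :: w] has [size w] steps.  The distance between vertices that no
   walk joins is [ereal_inf set0 = +oo]. *)
Definition graph_dist P u v : \bar R :=
  ereal_inf [set (size w)%:R%:E | w in
    [set w : seq E | path (fun x y => `[< adjacent P x y >]) u w
                     /\ last u w = v]].

Definition diameter P : \bar R :=
  ereal_sup [set graph_dist P u v | u in is_vertex P & v in is_vertex P].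

End Polytopes.

(* Main.v *)
Require Import Defs.
From mathcomp Require Import all_boot all_order all_algebra.
From mathcomp Require Import all_classical all_reals all_analysis.
From mathcomp Require Import ring lra.

(** A walk in the graph of [P + Q] projects onto a walk in the graph of [P] that
is no longer.  If a linear functional attains its maximum over [P + Q] at the
single point [z = p + q], then its maximum over [P] is attained only at [p] and
its maximum over [Q] only at [q]; so a vertex [z] of [P + Q] determines [p],
and [p] is a vertex of [P] ([exposes_sum], [sum_decomposition_unique]).  In the
same way an edge of [P + Q] joining [p + q] to [p' + q'] is the sum of a face of
[P] containing [p] and [p'] and a face of [Q].  The face of [P], translated by
[q], lies in that edge, so [p] and [p'] are equal or adjacent
([adjacent_sum]).

Conversely every vertex [v] of [P] is the projection of some vertex [v + q] of
[P + Q] ([vertex_lift]): a functional [c] that singles out [v] in [P] may be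
constant on a large face of [Q], but a small perturbation of [c] singles out one
generator [q] of [Q] and still singles out [v] in [P].  Hence any two vertices
[u], [v] of [P] are projections of vertices of [P + Q] at distance at least
[graph_dist P u v].  The bound for [Q] follows by commutativity. *)

Set Implicit Arguments.
Unset Strict Implicit.
Unset Printing Implicit Defensive.

Import Order.TTheory GRing.Theory Num.Theory.

Local Open Scope classical_set_scope.
Local Open Scope ring_scope.

Section MinkowskiSumDiameter.
Variables (R : realType) (n : nat).
Local Notation E := 'rV[R]_n.
Implicit Types (P Q F : set E) (c d p q u v w x y z : E) (s : seq E).

(** * Linear functionals and the points they expose *)

Definition dot x c : R := (x *m c^T) 0 0.

Lemma dotDl x y c : dot (x + y) c = dot x c + dot y c.
Proof. by rewrite /dot mulmxDl mxE. Qed.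

Lemma dotZl a x c : dot (a *: x) c = a * dot x c.
Proof. by rewrite /dot -scalemxAl mxE. Qed.

Lemma dotC x c : dot x c = dot c x.
Proof. by rewrite /dot -[x *m _]trmxK trmx_mul trmxK mxE. Qed.

Lemma dotDr x c d : dot x (c + d) = dot x c + dot x d.
Proof. by rewrite dotC dotDl !(dotC x). Qed.

Lemma dotZr a x c : dot x (a *: c) = a * dot x c.
Proof. by rewrite dotC dotZl (dotC x). Qed.

Lemma dot_gt0 x : x != 0 -> 0 < dot x x.
Proof.
move=> x0; have dotE : dot x x = \sum_i x 0 i ^+ 2.
  by rewrite /dot mxE; apply: eq_bigr => i _; rewrite mxE expr2.
have ge0 i : true -> 0 <= x 0 i ^+ 2 by rewrite sqr_ge0.
rewrite lt_neqAle dotE sumr_ge0// andbT eq_sym.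
apply: contra x0 => /eqP/(psumr_eq0P ge0) x0.
by apply/eqP/rowP => i; rewrite mxE; apply/eqP; rewrite -sqrf_eq0 x0.
Qed.

(** Among points of norm at most that of [q], the functional [dot ^~ q] is
maximal only at [q], since [|q - x|^2 > 0]. *)
Lemma dot_lt_of_norm_le x q : x != q -> dot x x <= dot q q -> dot x q < dot q q.
Proof.
move=> xq le; have : 0 < dot (q + (-1) *: x) (q + (-1) *: x).
  by apply: dot_gt0; rewrite scaleN1r subr_eq0 eq_sym.
rewrite !(dotDl, dotDr, dotZl, dotZr) (dotC q x); lra.
Qed.

Definition exposes c P v :=
  P v /\ forall x, P x -> x != v -> dot x c < dot v c.

Lemma exposes_max c P v x : exposes c P v -> P x -> dot x c <= dot v c.
Proof. by case=> _ vP xP; case: (eqVneq x v) => [->//|/(vP _ xP)/ltW]. Qed.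

Lemma exposes_eq c P v x :
  exposes c P v -> P x -> dot v c <= dot x c -> x = v.
Proof.
case=> _ vP xP le; apply/eqP/negPn/negP => /(vP _ xP).
by rewrite ltNge le.
Qed.

Lemma affine_hull_set1 v : affine_hull [set v] = [set v].
Proof.
apply/seteqP; split=> [y [k [a [x [xv a1 ->]]]]|_ ->] /=.
  under eq_bigr => i _ do rewrite (xv i).
  by rewrite -scaler_suml a1 scale1r.
exists 1%N, (fun=> 1), (fun=> v).
by split=> //; rewrite big_ord1// scale1r.
Qed.

Lemma vertexP P v : is_vertex P v <-> exists c, exposes c P v.
Proof.
split=> [[[c [b [le PE]]] _]|[c cv]].
  have [Pv vb] : P v /\ dot v c = b.
    by have : [set v] v by []; rewrite PE.
  exists c; split=> // x Px xv; rewrite lt_neqAle vb le// andbT.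
  by apply: contra xv => /eqP xb; apply/eqP; have : [set v] x by rewrite PE.
have [Pv _] := cv; split.
  exists c, (dot v c); split=> [x|]; first exact: exposes_max.
  apply/seteqP; split=> [_ -> //|x [Px xv]] /=.
  by apply: (exposes_eq cv) => //; rewrite -xv.
exists v, 0%VS; split; first exact: dimv0.
rewrite affine_hull_set1; apply/seteqP; split=> [_ ->|_ [w /= +] <-] /=.
  by exists 0; rewrite ?addr0//= mem0v.
by rewrite memv0 => /eqP ->; rewrite addr0.
Qed.

(** The points below the level of [v], together with [v] itself, form a convex
set, so it is enough to compare [v] with the generators. *)
Lemma exposes_hull c s v : convex_hull [set` s] v ->
    (forall x, x \in s -> x != v -> dot x c < dot v c) ->
  exposes c (convex_hull [set` s]) v.
Proof.
move=> sv lts; split=> // x sx /negP xv.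
suff /orP[//|] : (x == v) || (dot x c < dot v c) by [].
move: x sx {xv}; apply: smallest_sub => [|x /= xs].
  2: by have [//|xv /=] := eqVneq x v; exact: lts.
apply/convex_setW => x y; rewrite !inE => xS yS k k0 k1; rewrite inE.
(* [conv k x y] unfolds to this combination. *)
change (is_true ((k%:num *: x + (1 - k%:num) *: y == v) ||
  (dot (k%:num *: x + (1 - k%:num) *: y) c < dot v c))).
have [<-|kv] := eqVneq; first by [].
rewrite dotDl !dotZl /=.
case/orP: xS kv => [/eqP->|xS]; case/orP: yS => [/eqP->|yS] kv //.
- by rewrite -scalerDl addrC subrK scale1r eqxx in kv.
- nra.
- nra.
- nra.
Qed.

(** * Lifting vertices of a summand to vertices of the sum *)

Lemma seq_argmax (disp : Order.disp_t) (T : orderType disp) (f : E -> T) s :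
  s != [::] -> exists2 v, v \in s & forall x, x \in s -> (f x <= f v)%O.
Proof.
elim: s => // a [|b s] IH _.
  by exists a; rewrite ?mem_head// => x; rewrite inE => /eqP ->.
have [//|v vs vmax] := IH; have [av|va] := leP (f a) (f v).
  by exists v => [|x]; rewrite inE ?vs ?orbT// => /orP[/eqP->//|/vmax].
exists a => [|x]; rewrite inE ?eqxx// => /orP[/eqP->//|/vmax xv].
exact: le_trans xv (ltW va).
Qed.

(** If [v] is the only maximizer over [s] of [c], with ties broken by [d], then
it is the only maximizer of [c + e *: d] for all small [e > 0].  The bound on
[e] is uniform so that two lists can be treated with the same [e]. *)
Lemma perturbed_maximizer s v c d :
    (forall x, x \in s -> x != v ->
       dot x c < dot v c \/ dot x c = dot v c /\ dot x d < dot v d) ->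
  exists2 e0, 0 < e0 & forall e, 0 < e -> e <= e0 ->
    forall x, x \in s -> x != v -> dot x (c + e *: d) < dot v (c + e *: d).
Proof.
elim: s => [_|a s IH lex]; first by exists 1.
have [x xs|e0 e00 small] := IH.
  by apply: lex; rewrite inE xs orbT.
suff [e1 e10 ha] : exists2 e1, 0 < e1 & forall e, 0 < e -> e <= e1 ->
    a != v -> dot a (c + e *: d) < dot v (c + e *: d).
  exists (Num.min e0 e1) => [|e e_gt0]; first by rewrite lt_min e00.
  rewrite le_min => /andP[ee0 ee1] x.
  by rewrite inE => /orP[/eqP->|]; [exact: ha | exact: small].
have [->|av] := eqVneq a v; first by exists 1.
have [lt_c|[eq_c lt_d]] := lex a (mem_head _ _) av; last first.
  by exists 1 => // e e_gt0 _ _; rewrite !dotDr !dotZr eq_c ltrD2l ltr_pM2l.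
(* The gain of [a] over [v] along [d], at most [e * b], must stay below the
   deficit [dot v c - dot a c]; the [1 +] makes the division legitimate. *)
pose b := 1 + `|dot a d - dot v d|; have b0 : 0 < b by rewrite ltr_wpDr.
exists ((dot v c - dot a c) / b) => [|e e_gt0]; first by rewrite divr_gt0 ?subr_gt0.
rewrite ler_pdivlMr// => eb _; rewrite !dotDr !dotZr.
have := ler_norm (dot a d - dot v d); rewrite /b in eb *; nra.
Qed.

(** Among the generators of [Q] that maximize [c], one of largest norm is taken
for [q]: then [q] itself, used as a functional, breaks the ties. *)
Lemma vertex_lift P Q v : is_polytope P -> is_polytope Q -> is_vertex P v ->
  exists2 q, Q q & is_vertex (minkowski_sum P Q) (v + q).
Proof.
move=> [s s0 ->] [t t0 ->] /vertexP[c [vP cv]].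
have gen r x : x \in r -> convex_hull [set` r] x.
  by move=> xr; exact: (sub_smallest (@subset_refl _ _)).
have [q qt qmax] :=
  seq_argmax (fun x => (dot x c, dot x x) : (R *l R)%type) t0.
have [e1 e10 h1] : exists2 e0, 0 < e0 & forall e, 0 < e -> e <= e0 ->
    forall x, x \in s -> x != v -> dot x (c + e *: q) < dot v (c + e *: q).
  by apply: perturbed_maximizer => x /gen xP xv; left; exact: cv.
have [e2 e20 h2] : exists2 e0, 0 < e0 & forall e, 0 < e -> e <= e0 ->
    forall x, x \in t -> x != q -> dot x (c + e *: q) < dot q (c + e *: q).
  apply: perturbed_maximizer => x xt xq.
  have := qmax x xt; rewrite lexi_pair => /andP[].
  rewrite le_eqVlt => /orP[/eqP eq_c|]; last by left.
  rewrite eq_c lexx /= => le_norm; right.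
  by split=> //; exact: dot_lt_of_norm_le.
pose e := Num.min e1 e2; have e0 : 0 < e by rewrite lt_min e10.
have ev : exposes (c + e *: q) (convex_hull [set` s]) v.
  by apply: exposes_hull => //; apply: h1; rewrite // ge_min lexx.
have eq : exposes (c + e *: q) (convex_hull [set` t]) q.
  by apply: exposes_hull; [exact: gen | apply: h2; rewrite // ge_min lexx orbT].
exists q; first exact: gen.
apply/vertexP; exists (c + e *: q); split.
  by exists v => //; exists q => //; exact: gen.
move=> _ [x xP [y yQ <-]] ne; rewrite !dotDl.
have [xv|xv] := eqVneq x v.
  have [yq|yq] := eqVneq y q; first by rewrite xv yq eqxx in ne.
  by rewrite xv ltrD2l; case: eq => _; exact.
by apply: ltr_leD; [case: ev => _; exact | exact: exposes_max yQ].
Qed.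

(** * Projecting walks from the sum to a summand *)

Lemma minkowski_sumC P Q : minkowski_sum P Q = minkowski_sum Q P.
Proof.
by apply/seteqP; split=> _ [x xP [y yQ <-]];
  exists y => //; exists x => //; rewrite addrC.
Qed.

Lemma sum_mem P Q p q : P p -> Q q -> minkowski_sum P Q (p + q).
Proof. by move=> Pp Qq; exists p => //; exists q. Qed.

Lemma exposes_sum c P Q p q : P p -> Q q ->
  exposes c (minkowski_sum P Q) (p + q) -> exposes c P p.
Proof.
move=> Pp Qq [_ lt]; split=> // x Px xp.
have := lt (x + q) (sum_mem Px Qq).
by rewrite (inj_eq (addIr q)) !dotDl ltrD2r => /(_ xp).
Qed.

Lemma sum_decomposition_unique P Q p q p' q' : P p -> Q q -> P p' -> Q q' ->
  is_vertex (minkowski_sum P Q) (p + q) -> p + q = p' + q' -> p = p'.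
Proof.
move=> Pp Qq Pp' Qq' /vertexP[c cz] eq_pq.
apply/esym/(exposes_eq (exposes_sum Pp Qq cz)) => //.
(* [p + q'] also belongs to the sum, hence lies below [p' + q']. *)
by have := exposes_max cz (sum_mem Pp Qq'); rewrite eq_pq !dotDl lerD2r.
Qed.

Lemma affine_hull_sub F : F `<=` affine_hull F.
Proof.
move=> x Fx; exists 1%N, (fun=> 1), (fun=> x).
by split=> //; rewrite big_ord1// scale1r.
Qed.

Lemma has_dim1_line F p p' : F p -> F p' -> p != p' ->
  (forall x, F x -> x - p \in <[p' - p]>%VS) -> has_dim F 1%N.
Proof.
move=> Fp Fp' pp' sub; exists p, <[p' - p]>%VS; split.
  by rewrite dim_vline subr_eq0 eq_sym pp'.
apply/seteqP; split=> [y [k [a [x [Fx a1 ->]]]]|_ [w /= /vlineP[t ->] <-]].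
  exists (\sum_i a i *: (x i - p)) => /=.
    by apply: memv_suml => i _; apply: memvZ; exact: sub.
  under eq_bigr => i _ do rewrite scalerBr.
  by rewrite sumrB -scaler_suml a1 scale1r addrC subrK.
exists 2%N, (fun i => if i == 0 then 1 - t else t),
  (fun i => if i == 0 then p else p'); split.
- by move=> i; case: ifP.
- by rewrite big_ord_recl big_ord1 /= subrK.
- rewrite big_ord_recl big_ord1 /= scalerBl scale1r scalerBr.
  by rewrite addrA addrAC.
Qed.

(** The points of [P] at the level of [p] form a face that, translated by [q],
lies in the edge of [P + Q]; so that face is a segment. *)
Lemma adjacent_sum P Q p q p' q' : P p -> Q q -> P p' -> Q q' ->
  Defs.adjacent (minkowski_sum P Q) (p + q) (p' + q') ->
  p = p' \/ Defs.adjacent P p p'.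
Proof.
move=> Pp Qq Pp' Qq' [_ /vertexP[c1 z1] /vertexP[c2 z2] [F [eF Fz Fz']]].
case: eF Fz Fz' => -[c [b [le FE]]] [p0 [U [dU hU]]].
rewrite FE => -[_ zb] [_ z'b].
change (dot (p + q) c = b) in zb.
change (dot (p' + q') c = b) in z'b.
have {}le x y : P x -> Q y -> dot x c + dot y c <= b.
  by move=> Px Qy; rewrite -dotDl; exact: le (sum_mem Px Qy).
have [->|pp'] := eqVneq p p'; [by left | right].
pose G := [set x | P x /\ dot x c = dot p c].
have Gp' : G p'.
  split=> //; move: (le _ _ Pp Qq') (le _ _ Pp' Qq) zb z'b.
  by rewrite !dotDl; lra.
have GU x : G x -> x + q - p0 \in U.
  move=> [Px xp]; have : affine_hull F (x + q).
    apply: affine_hull_sub; rewrite FE; split; first exact: sum_mem.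
    by change (dot (x + q) c = b); rewrite -zb !dotDl xp.
  by rewrite hU => -[w wU <-]; rewrite addrC addKr.
have GpU x : G x -> x - p \in U.
  move=> Gx; have -> : x - p = (x + q - p0) - (p + q - p0).
    by rewrite opprB addrA subrK opprD addrA addrAC addrK.
  by apply: rpredB; apply: GU.
have UE : U = <[p' - p]>%VS.
  apply/esym/eqP; rewrite eqEdim -memvE GpU//= dU dim_vline subr_eq0.
  by rewrite eq_sym pp'.
split; [exact/eqP | | | exists G; split=> //; split].
- by apply/vertexP; exists c1; exact: exposes_sum z1.
- by apply/vertexP; exists c2; exact: exposes_sum z2.
- exists c, (dot p c); split=> [x Px|//].
  by have := le x q Px Qq; rewrite -zb dotDl lerD2r.
- by apply: (@has_dim1_line _ p p') => // x Gx; rewrite -UE; exact: GpU.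
Qed.

(** Steps that move only the [Q]-component are dropped, so the projected walk may
be shorter. *)
Lemma walk_projection P Q p q p' q' (r : seq E) :
    P p -> Q q -> P p' -> Q q' -> is_vertex (minkowski_sum P Q) (p + q) ->
    path (fun x y => `[< Defs.adjacent (minkowski_sum P Q) x y >]) (p + q) r ->
    last (p + q) r = p' + q' ->
  exists r' : seq E, [/\ path (fun x y => `[< Defs.adjacent P x y >]) p r',
    last p r' = p' & (size r' <= size r)%N].
Proof.
move=> + + Pp' Qq'; elim: r p q => [|z r IH] p q Pp Qq vz /=.
  move=> _ eq_pq; exists [::]; split=> //=.
  exact: (sum_decomposition_unique Pp Qq Pp' Qq').
move=> /andP[/asboolP adj walk] lastE; have [_ _ vz' _] := adj.
have /vertexP[_ [[x Px [y Qy xyz]] _]] := vz'; subst z.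
have [r' [w' l' s']] := IH x y Px Qy vz' walk lastE.
have [->|px] := adjacent_sum Pp Qq Px Qy adj.
  by exists r'; split=> //; exact: leqW.
by exists (x :: r'); split=> //=; rewrite w' andbT; apply/asboolP.
Qed.

(** * Comparing diameters *)

Lemma diameter_le_sum P Q : is_polytope P -> is_polytope Q ->
  (diameter P <= diameter (minkowski_sum P Q))%E.
Proof.
move=> hP hQ; apply: ge_ereal_sup => _ [u vu [v vv <-]].
have [q Qq uq] := vertex_lift hP hQ vu.
have [q' Qq' vq'] := vertex_lift hP hQ vv.
have vertex_mem x : is_vertex P x -> P x by case/vertexP => c [].
apply: (@le_trans _ _ (graph_dist (minkowski_sum P Q) (u + q) (v + q'))).
  apply: le_ereal_inf_tmp => _ [r [walk lastE] <-].
  have [r' [walk' last' sz]] := walk_projection (vertex_mem _ vu) Qq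
    (vertex_mem _ vv) Qq' uq walk lastE.
  apply: (@le_trans _ _ (size r')%:R%:E); last by rewrite lee_fin ler_nat.
  by apply: ereal_inf_lbound; exists r'.
by apply: ereal_sup_ubound; exists (u + q) => //; exists (v + q').
Qed.

End MinkowskiSumDiameter.

Theorem theorem3p1 (R : realType) (n : nat) (P Q : set 'rV[R]_n)
    (hP : is_polytope P) (hQ : is_polytope Q) :
  (diameter (minkowski_sum P Q) >= maxe (diameter P) (diameter Q))%E.
Proof.
rewrite ge_max diameter_le_sum//=.
by rewrite minkowski_sumC diameter_le_sum.
Qed.
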